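(* Let $(N,M,\boldsymbol q)$ be a setting, let $\varphi$ be a strategyproof mechanism, and let $\psi$ be a mechanism that is weakly less varying than $\varphi$ but not upper invariant. Then for every $\beta\in(0,1]$ and every $r\in(0,1]$, the hybrid $h^\beta=(1-\beta)\varphi+\beta\psi$ is not $r$-partially strategyproof.
   Context: A setting $(N,M,\boldsymbol q)$ consists of a finite set $N$ of $n$ agents, a finite set $M$ of $m$ objects, and a vector $\boldsymbol q=(q_j)_{j\in M}$ of capacities (positive integers; there are $q_j$ units of object $j$) with $n\le\sum_{j\in M}q_j$. $\mathcal P$ is the set of strict preference orders (linear orders) over $M$; $P:a\succ b$ means that $a$ is strictly preferred to $b$ under $P$. A preference profile is an element $(P_i,P_{-i})\in\mathcal P^N$, where $P_{-i}$ are the orders of all agents except $i$. A utility function $u:M\to\mathbb R^+$ is consistent with $P$ if $u(a)>u(b)$ whenever $P:a\succ b$; $U_P$ is the set of utility functions consistent with $P$. An assignment is an $N\times M$ matrix $x$ with $x_{i,j}\in[0,1]$, $\sum_{j\in M}x_{i,j}=1$ for all $i\in N$, and $\sum_{i\in N}x_{i,j}\le q_j$ for all $j\in M$; $\Delta(X)$ is the set of assignments. A mechanism is a map $\varphi:\mathcal P^N\to\Delta(X)$; $\varphi_i(P_i,P_{-i})$ is the row of agent $i$, with entries $\varphi_{i,j}(P_i,P_{-i})$. Hybrids are pointwise convex combinations. Write $\langle u,v\rangle=\sum_{j\in M}u(j)v_j$. $\varphi$ is strategyproof if $\langle u_i,\varphi_i(P_i,P_{-i})-\varphi_i(P_i',P_{-i})\rangle\ge0$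 for all $i\in N$, $(P_i,P_{-i})\in\mathcal P^N$, $P_i'\in\mathcal P$, $u_i\in U_{P_i}$. For $r\in[0,1]$, $u\in U_P$ satisfies URBI($r$) if for all $a,b\in M$ with $P:a\succ b$ we have $r\,(u(a)-\min_{j\in M}u(j))\ge u(b)-\min_{j\in M}u(j)$. A mechanism is $r$-partially strategyproof if the inequality in the definition of strategyproofness holds for all $i$, $(P_i,P_{-i})$, $P_i'$, and all $u_i\in U_{P_i}$ satisfying URBI($r$). The neighborhood $N_P$ of $P\in\mathcal P$ is the set of orders obtained from $P$ by swapping two objects that are adjacent in $P$. A mechanism $\psi$ is upper invariant if for all $i$, $(P_i,P_{-i})$, and $P_i'\in N_{P_i}$ with $P_i:a\succ b$ and $P_i':b\succ a$, we have $\psi_{i,j}(P_i,P_{-i})=\psi_{i,j}(P_i',P_{-i})$ for all $j\in M$ with $P_i:j\succ a$. $\psi$ is weakly less varying than $\varphi$ if for all $i$, $(P_i,P_{-i})$, and $P_i'\in N_{P_i}$: $\varphi_i(P_i,P_{-i})=\varphi_i(P_i',P_{-i})$ implies $\psi_i(P_i,P_{-i})=\psi_i(P_i',P_{-i})$. *)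

(* Defs.v *)
From HB Require Import structures.
From mathcomp Require Import all_boot all_order all_fingroup all_algebra.
From mathcomp Require Import reals.

Set Implicit Arguments.
Unset Strict Implicit.
Unset Printing Implicit Defensive.

Import Order.TTheory GRing.Theory Num.Theory.

Local Open Scope ring_scope.

Section Preferences.
Variables (N M : finType).

Definition strict_linear (S : {set M * M}) : bool :=
  [&& [forall a, (a, a) \notin S],
      [forall a, forall b, forall c,
         ((a, b) \in S) ==> ((b, c) \in S) ==> ((a, c) \in S)]
    & [forall a, forall b, (a != b) ==> ((a, b) \in S) || ((b, a) \in S)]].

(* An order is stored as the graph of its strict part, so that extensionally
   equal orders are equal and no mechanism can tell them apart. *)
Definition pref := {S : {set M * M} | strict_linear S}.

HB.instance Definition _ := Finite.on pref.

Definition prefers (P : pref) (a b : M) : bool := (a, b) \in val P.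

Definition adjacent (P : pref) (a b : M) : Prop :=
  prefers P a b /\ forall c, ~ (prefers P a c /\ prefers P c b).

(* [P'] is the order [P] with the adjacent objects [a], [b] exchanged. *)
Definition neighbor (P P' : pref) : Prop :=
  exists a b, adjacent P a b /\
    forall c d, prefers P' c d = prefers P (tperm a b c) (tperm a b d).

Definition profile := {ffun N -> pref}.

(* [deviate P i P'] is the profile (P', P_{-i}). *)
Definition deviate (P : profile) (i : N) (P' : pref) : profile :=
  [ffun k => if k == i then P' else P k].

End Preferences.

Section Mechanisms.
Variables (R : realType) (N M : finType).

Definition is_assignment (q : M -> nat) (x : N -> M -> R) : Prop :=
  [/\ forall i j, 0 <= x i j <= 1,
      forall i, \sum_j x i j = 1
    & forall j, \sum_i x i j <= (q j)%:R].

(* The requirement that the values lie in the set of assignments is the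
   separate predicate [mechanism]. *)
Definition rule := profile N M -> N -> M -> R.

Definition mechanism (q : M -> nat) (phi : rule) : Prop :=
  forall P, is_assignment q (phi P).

Definition hybrid (beta : R) (phi psi : rule) : rule :=
  fun P i j => (1 - beta) * phi P i j + beta * psi P i j.

Definition consistent (P : pref M) (u : M -> R) : Prop :=
  (forall j, 0 < u j) /\ forall a b, prefers P a b -> u b < u a.

(* The base value [u a] only makes the iterated minimum over [M] well defined;
   it is itself one of the values, so the result is min_{j in M} u j. *)
Definition URBI (r : R) (P : pref M) (u : M -> R) : Prop :=
  forall a b, prefers P a b ->
    let umin := \big[Order.min/u a]_(j : M) u j in
    u b - umin <= r * (u a - umin).

Definition no_gain (phi : rule) (u : M -> R) (P : profile N M) (i : N)
    (P' : pref M) : Prop :=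
  0 <= \sum_j u j * (phi P i j - phi (deviate P i P') i j).

Definition strategyproof (phi : rule) : Prop :=
  forall i (P : profile N M) (P' : pref M) (u : M -> R),
    consistent (P i) u -> no_gain phi u P i P'.

Definition partially_strategyproof (r : R) (phi : rule) : Prop :=
  forall i (P : profile N M) (P' : pref M) (u : M -> R),
    consistent (P i) u -> URBI r (P i) u -> no_gain phi u P i P'.

Definition upper_invariant (psi : rule) : Prop :=
  forall i (P : profile N M) (P' : pref M), neighbor (P i) P' ->
  forall a b, prefers (P i) a b -> prefers P' b a ->
  forall j, prefers (P i) j a -> psi P i j = psi (deviate P i P') i j.

Definition weakly_less_varying (psi phi : rule) : Prop :=
  forall i (P : profile N M) (P' : pref M), neighbor (P i) P' ->
    phi P i =1 phi (deviate P i P') i -> psi P i =1 psi (deviate P i P') i.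

Lemma hybrid_mechanism (q : M -> nat) (beta : R) (phi psi : rule) :
  0 <= beta <= 1 -> mechanism q phi -> mechanism q psi ->
  mechanism q (hybrid beta phi psi).
Proof.
move=> /andP[b0 b1] hphi hpsi P.
have [p01 psum pcap] := hphi P; have [s01 ssum scap] := hpsi P.
have c0 : 0 <= 1 - beta by rewrite subr_ge0.
split=> [i j|i|j]; rewrite /hybrid.
- have /andP[p0 p1] := p01 i j; have /andP[s0 s1] := s01 i j.
  rewrite addr_ge0 ?mulr_ge0 //=.
  by rewrite -[leRHS](subrK beta) lerD // ler_piMr.
- by rewrite big_split /= -!mulr_sumr psum ssum !mulr1 subrK.
- rewrite big_split /= -!mulr_sumr.
  have -> : (q j)%:R = (1 - beta) * (q j)%:R + beta * (q j)%:R.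
    by rewrite -mulrDl subrK mul1r.
  by rewrite lerD // ler_wpM2l.
Qed.

End Mechanisms.

(* Main.v *)
Require Import Defs.
From mathcomp Require Import all_boot all_order all_fingroup all_algebra.
From mathcomp Require Import reals lra.

Import Order.TTheory GRing.Theory Num.Theory.

Local Open Scope ring_scope.

(* For every [r > 0], [r]-partial strategyproofness forces upper invariance:
   URBI([r]) admits utilities that decay geometrically along the order, so an
   agent compares two rows lexicographically from the top object downwards.
   Both [phi] and the hybrid would then be upper invariant, hence so would
   [psi], as [beta > 0]. *)

Lemma prefers_irr (M : finType) (P : pref M) a : prefers P a a = false.
Proof.
by apply/negbTE; have /and3P[/forallP irr _ _] := valP P; apply: irr.
Qed.

Lemma prefers_trans (M : finType) (P : pref M) a b c :
  prefers P a b -> prefers P b c -> prefers P a c.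
Proof.
have /and3P[_ tr _] := valP P.
by move: tr => /forallP/(_ a)/forallP/(_ b)/forallP/(_ c)/implyP h ab;
  apply/implyP/h.
Qed.

Lemma prefers_total (M : finType) (P : pref M) a b :
  a != b -> prefers P a b || prefers P b a.
Proof.
have /and3P[_ _ tot] := valP P.
by move: tot => /forallP/(_ a)/forallP/(_ b)/implyP; apply.
Qed.

Lemma prefers_asym (M : finType) (P : pref M) a b :
  prefers P a b -> prefers P b a = false.
Proof.
move=> ab; apply/negbTE/negP => ba.
by have := prefers_trans M P a b a ab ba; rewrite prefers_irr.
Qed.

Definition rank (M : finType) (P : pref M) (a : M) : nat :=
  #|[pred b | prefers P b a]|.

Lemma ltn_rank (M : finType) (P : pref M) a b :
  prefers P a b -> (rank M P a < rank M P b)%N.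
Proof.
move=> ab; apply/proper_card/properP; split.
  by apply/subsetP => c; rewrite !inE => ca; apply: prefers_trans ca ab.
by exists a; rewrite !inE ?prefers_irr.
Qed.

(** The top object has rank 0 and utility 1; each step down the order multiplies the utility by
    [d]. *)
Definition geometric_utility (R : realType) (M : finType) (P : pref M)
  (d : R) (a : M) : R := d ^+ rank M P a.

Lemma geometric_utility_le (R : realType) (M : finType) (P : pref M) (d : R)
    a b : 0 < d < 1 -> prefers P a b ->
  geometric_utility R M P d b <= d * geometric_utility R M P d a.
Proof.
move=> /andP[d0 d1] ab; rewrite /geometric_utility -exprS.
by rewrite ler_wiXn2l ?ltW // ltn_rank.
Qed.

Lemma geometric_utility_consistent (R : realType) (M : finType) (P : pref M)
    (d : R) : 0 < d < 1 -> consistent P (geometric_utility R M P d).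
Proof.
move=> d01; have /andP[d0 d1] := d01; split=> [a|a b ab]; first exact: exprn_gt0.
apply: le_lt_trans (geometric_utility_le _ _ _ _ _ _ d01 ab) _.
by rewrite gtr_pMl // exprn_gt0.
Qed.

(** Since [u b <= d * u a <= r * u a], it remains to see that subtracting [umin] on the left costs
    no less than subtracting [r * umin] on the right, which is [0 <= (1 - r) * umin]. *)
Lemma geometric_utility_URBI (R : realType) (M : finType) (P : pref M)
    (d r : R) : 0 < d < 1 -> d <= r <= 1 ->
  URBI r P (geometric_utility R M P d).
Proof.
move=> d01 /andP[dr r1] a b ab; have /andP[d0 d1] := d01.
set umin := \big[_/_]_(_ | _) _ => /=.
have u0 c : 0 <= geometric_utility R M P d c by rewrite exprn_ge0 // ltW.
have m0 : 0 <= umin by apply: le_bigmin.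
have ub := geometric_utility_le _ _ _ _ _ _ d01 ab.
have := ler_wpM2r (u0 a) dr; have : 0 <= (1 - r) * umin.
  by rewrite mulr_ge0 // subr_ge0.
by lra.
Qed.

(** Otherwise the misreport wins [t > 0] at [j], changes nothing above [j], and under a steep enough
    geometric utility loses less than that below [j]. *)
Lemma partially_strategyproof_lexicographic (R : realType) (N M : finType)
    (phi : rule R N M) (r : R) (i : N) (P : profile N M) (P' : pref M) (j : M) :
  0 < r <= 1 -> partially_strategyproof r phi ->
  (forall k, prefers (P i) k j -> phi P i k = phi (deviate P i P') i k) ->
  phi (deviate P i P') i j <= phi P i j.
Proof.
move=> /andP[r0 r1] psp above.
rewrite leNgt; apply/negP => lt_j.
pose D k := phi P i k - phi (deviate P i P') i k.
pose S := \sum_(k | k != j) `|D k|.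
have S0 : 0 <= S by apply: sumr_ge0.
pose t := - D j; have t0 : 0 < t by rewrite oppr_gt0 subr_lt0.
(* The factor [r] yields URBI([r]), and the fraction yields [d * S < t]; the summand 1 keeps the
   fraction strictly below 1 even when [S = 0]. *)
pose d := r * (t / (1 + t + S)).
have den0 : 0 < 1 + t + S by lra.
have frac0 : 0 < t / (1 + t + S) by rewrite divr_gt0.
have frac1 : t / (1 + t + S) < 1 by rewrite ltr_pdivrMr // mul1r; lra.
have d0 : 0 < d by rewrite mulr_gt0.
have dr : d < r by rewrite gtr_pMr.
have d01 : 0 < d < 1 by rewrite d0 (lt_le_trans dr).
have dS : d * S < t.
  apply: (@le_lt_trans _ _ (t / (1 + t + S) * S)).
    by rewrite ler_wpM2r // ler_piMl // ltW.
  by rewrite mulrAC ltr_pdivrMr // ltr_pM2l //; lra.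
set u := geometric_utility R M (P i) d.
have uj0 : 0 < u j by apply: exprn_gt0.
have dr1 : d <= r <= 1 by rewrite ltW.
have := psp i P P' u (geometric_utility_consistent _ _ _ _ d01)
  (geometric_utility_URBI _ _ _ _ _ d01 dr1).
rewrite /no_gain (bigD1 j) //= -/(D j).
(* The expected gain from truthfulness is then at most [u j * (d * S - t) < 0]. *)
suff le_rest : \sum_(k | k != j) u k * D k <= u j * (d * S).
  move=> ge0; have : 0 <= u j * (D j + d * S).
    by rewrite mulrDr (le_trans ge0) // lerD2l.
  by rewrite pmulr_rge0 // leNgt => /negP; apply; rewrite /t in dS; lra.
rewrite !mulr_sumr; apply: ler_sum => k kj.
have [kj'|jk] := orP (prefers_total _ (P i) _ _ kj).
  by rewrite /D above // subrr normr0 !mulr0.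
have uk0 : 0 < u k by apply: exprn_gt0.
apply: le_trans (ler_wpM2l (ltW uk0) (ler_norm _)) _.
by rewrite mulrA ler_wpM2r // mulrC geometric_utility_le.
Qed.

Lemma deviate_at (N M : finType) (P : profile N M) i P' :
  deviate P i P' i = P'.
Proof. by rewrite ffunE eqxx. Qed.

Lemma deviateK (N M : finType) (P : profile N M) i P' :
  deviate (deviate P i P') i (P i) = P.
Proof. by apply/ffunP => k; rewrite !ffunE; case: eqP => // ->. Qed.

Lemma adjacent_below (M : finType) (P : pref M) a b c :
  adjacent P a b -> c != a -> prefers P c b = prefers P c a.
Proof.
move=> [ab noc] ca; apply/idP/idP => [cb|ca']; last exact: prefers_trans ca' ab.
by have [//|ac] := orP (prefers_total _ P _ _ ca); case: (noc c).
Qed.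

Lemma adjacent_above (M : finType) (P : pref M) a b c :
  adjacent P a b -> c != b -> prefers P a c = prefers P b c.
Proof.
move=> [ab noc] cb; apply/idP/idP => [ac|bc]; last exact: prefers_trans ab bc.
by have [cb'|//] := orP (prefers_total _ P _ _ cb); case: (noc c).
Qed.

(** Every third object compares alike with [a] and with [b], because nothing lies between them. *)
Lemma adjacent_swap (M : finType) (P : pref M) a b c d :
  adjacent P a b -> (c, d) != (a, b) -> (c, d) != (b, a) ->
  prefers P (tperm a b c) (tperm a b d) = prefers P c d.
Proof.
move=> adj; rewrite !xpair_eqE.
case: tpermP => [->|->|/eqP ca /eqP cb]; case: tpermP => [->|->|/eqP da /eqP db];
  rewrite ?eqxx ?prefers_irr //= => _ _.
- by rewrite (adjacent_above _ _ _ _ _ adj).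
- by rewrite (adjacent_above _ _ _ _ _ adj).
- by rewrite (adjacent_below _ _ _ _ _ adj).
- by rewrite (adjacent_below _ _ _ _ _ adj).
Qed.

Lemma neighbor_above (M : finType) (P P' : pref M) a b j k :
  neighbor P P' -> prefers P a b -> prefers P' b a -> prefers P j a ->
  prefers P' k j = prefers P k j.
Proof.
move=> [a0 [b0 [adj sw]]] ab ba ja.
have [ab0 _] := adj.
(* Only the swapped pair changes its comparison, so a reversed pair must be the swapped one. *)
have [ea eb] : a = a0 /\ b = b0.
  have [[-> ->] //|nab] := eqVneq (b, a) (b0, a0).
  have [[eb ea]|nba] := eqVneq (b, a) (a0, b0).
    by move: ab0; rewrite -ea -eb prefers_asym.
  by move: ba; rewrite sw adjacent_swap // prefers_asym.
subst a0 b0; rewrite sw adjacent_swap //; apply/eqP => -[_ ej]; move: ja.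
  by rewrite ej prefers_asym.
by rewrite ej prefers_irr.
Qed.

(** Going down from the top object to [a], the lexicographic comparison applies in both directions
    between the neighboring orders and forces equal entries. *)
Lemma partially_strategyproof_upper_invariant (R : realType) (N M : finType)
    (phi : rule R N M) (r : R) :
  0 < r <= 1 -> partially_strategyproof r phi -> upper_invariant phi.
Proof.
move=> hr psp i P P' nb a b ab ba j.
have [n] := ubnP (rank M (P i) j); elim: n j => // n IHn j rank_j ja.
have above k : prefers (P i) k j -> phi P i k = phi (deviate P i P') i k.
  move=> kj; apply: IHn; last exact: prefers_trans kj ja.
  by apply: leq_trans (ltn_rank _ _ _ _ kj) _; rewrite -ltnS.
apply/eqP; rewrite eq_le; apply/andP; split; last first.
  exact: partially_strategyproof_lexicographic hr psp above.
(* Exchange the roles of the true and the misreported order. *)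
rewrite -{1}(deviateK _ _ P i P').
apply: (partially_strategyproof_lexicographic _ _ _ _ _ _ _ _ _ hr psp) => k.
(* Both orders have the same objects above [j], so the induction hypothesis covers this direction
   too. *)
rewrite deviate_at deviateK (neighbor_above _ _ _ _ _ _ _ nb ab ba ja) => kj.
by rewrite above.
Qed.

Theorem proposition2 (R : realType) (N M : finType) (q : M -> nat)
    (hq : forall j, (0 < q j)%N) (hN : (#|N| <= \sum_(j : M) q j)%N)
    (phi psi : rule R N M)
    (hphi : mechanism q phi) (hpsi : mechanism q psi)
    (hsp : strategyproof phi)
    (hwlv : weakly_less_varying psi phi)
    (hnui : ~ upper_invariant psi)
    (beta : R) (hbeta : 0 < beta <= 1)
    (r : R) (hr : 0 < r <= 1) :
  ~ partially_strategyproof r (hybrid beta phi psi).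
Proof.
move=> psp; apply: hnui => i P P' nb a b ab ba j ja.
have phi_psp : partially_strategyproof r phi by move=> ? ? ? ? ? _; apply: hsp.
have phi_ui := partially_strategyproof_upper_invariant _ _ _ _ _ hr phi_psp.
have h_ui := partially_strategyproof_upper_invariant _ _ _ _ _ hr psp.
have /andP[/lt0r_neq0 beta_neq0 _] := hbeta.
have := h_ui i P P' nb a b ab ba j ja.
(* The [phi] terms agree and cancel, leaving the [psi] entries scaled by [beta]. *)
rewrite /hybrid (phi_ui i P P' nb a b ab ba j ja) => /addrI.
exact: mulfI.
Qed.
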